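(* Let $0<q<\infty$ and $0<p\le1$. Let $a=\{a(m)\}_{m\in\mathbb N}$, $b=\{b(m)\}_{m\in\mathbb N}$ and $u=\{u(m)\}_{m\in\mathbb N}$ be given sequences of non-negative real numbers with $b(1)>0$. Then the following six statements are equivalent (in each, the constant is finite and independent of the sequence $x$, respectively $y$): (i) The inequality $$\bigg(\sum_{m=1}^{\infty}\bigg(\sup_{m\le i<\infty}u(i)\sum_{k=1}^{i}x(k)\bigg)^q a(m)\bigg)^{\frac1q}\le C\bigg(\sum_{m=1}^\infty x(m)^p b(m)\bigg)^{\frac1p}$$ holds for all non-negative, non-increasing sequences $x=\{x(m)\}_{m\in\mathbb N}$. (ii) The inequality $$\bigg(\sum_{m=1}^\infty\bigg(\sup_{m\le i<\infty}u(i)\sum_{k=1}^i\bigg(\sum_{j=k}^\infty y(j)\bigg)^{\frac1p}\bigg)^q a(m)\bigg)^{\frac1q}\le D_1\bigg(\sum_{m=1}^\infty y(m)B(m)\bigg)^{\frac1p}$$ holds for all non-negative sequences $y=\{y(m)\}_{m\in\mathbb N}$. (iii) The inequality $$\bigg(\sum_{m=1}^\infty\bigg(\sup_{m\le i<\infty}u(i)^p\sum_{k=1}^i k^{p-1}\sum_{j=k}^\infty y(j)\bigg)^{\frac qp}a(m)\bigg)^{\frac1q}\le D_2\bigg(\sum_{m=1}^\infty y(m)B(m)\bigg)^{\frac1p}$$ holds for all non-negative sequences $y$. (iv) The inequality $$\bigg(\sum_{m=1}^\infty\bigg(\sup_{m\le i<\infty}u(i)^p\sup_{1\le k\le i}k^{p}\sum_{j=k}^\infty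 y(j)\bigg)^{\frac qp}a(m)\bigg)^{\frac1q}\le D_3\bigg(\sum_{m=1}^\infty y(m)B(m)\bigg)^{\frac1p}$$ holds for all non-negative sequences $y$. (v) The inequality $$\bigg(\sum_{m=1}^\infty\bigg(\sup_{m\le i<\infty}u(i)\sum_{k=1}^i\Big(\sup_{k\le j<\infty}y(j)\Big)^{\frac1p}\bigg)^{q}a(m)\bigg)^{\frac1q}\le D_4\bigg(\sum_{m=1}^\infty y(m)B(m)\bigg)^{\frac1p}$$ holds for all non-negative sequences $y$. (vi) The inequality $$\bigg(\sum_{m=1}^\infty\bigg(\sup_{m\le i<\infty}u(i)^p\sup_{1\le k\le i}k^{p}\sup_{k\le j<\infty}y(j)\bigg)^{\frac qp}a(m)\bigg)^{\frac1q}\le D_5\bigg(\sum_{m=1}^\infty y(m)B(m)\bigg)^{\frac1p}$$ holds for all non-negative sequences $y$. Moreover, if $C$ and $D_1,\dots,D_5$ denote the best constants in the inequalities of (i) and of (ii)–(vi), respectively, then $C\approx D_i$ for $i=1,\dots,5$, where the multiplicative constants in the equivalences depend only on $p$ and $q$.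
   Context: $\mathbb N=\{1,2,3,\dots\}$. All given sequences have finite non-negative real entries; sums and suprema are taken in $[0,\infty]$. Notation: $B(m)=\sum_{k=1}^m b(k)$ for $m\in\mathbb N$. Conventions: $0\cdot\infty=0$, $0/0=0$, $\infty/\infty=0$, $1/0=\infty$, $1/\infty=0$; $\infty^\alpha=\infty$ for $\alpha>0$ and $\infty^\alpha=0$ for $\alpha<0$. The best constant in an inequality is the infimum of all finite constants for which it holds for all admissible sequences, and it equals $\infty$ if there is no such constant. For $X,Y\in[0,\infty]$, $X\approx Y$ means $c^{-1}Y\le X\le cY$ for some positive finite constant $c$ (here depending only on $p$ and $q$). *)

(* Defs.v *)
From HB Require Import structures.
From mathcomp Require Import all_boot all_order all_algebra.
From mathcomp Require Import all_classical all_reals all_analysis.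

Set Implicit Arguments.
Unset Strict Implicit.
Unset Printing Implicit Defensive.

Import Order.TTheory GRing.Theory Num.Theory.
Import numFieldNormedType.Exports.

Local Open Scope classical_set_scope.
Local Open Scope ring_scope.
Local Open Scope ereal_scope.

(* Sequences indexed by {1, 2, 3, ...} are functions nat -> R whose value at 0
   is never used.  In \bar R, 0 * +oo = 0 and +oo `^ r = +oo for r > 0. *)

Definition nonneg_seq1 (R : realType) (x : nat -> R) : Prop :=
  forall m : nat, (1 <= m)%N -> (0 <= x m)%R.

Definition nonincreasing_seq1 (R : realType) (x : nat -> R) : Prop :=
  forall m n : nat, (1 <= m)%N -> (m <= n)%N -> (x n <= x m)%R.

Definition sup_from (R : realType) (m : nat) (F : nat -> \bar R) : \bar R :=
  ereal_sup [set F i | i in [set i : nat | (m <= i)%N]].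

Definition sup_upto (R : realType) (i : nat) (F : nat -> \bar R) : \bar R :=
  ereal_sup [set F k | k in [set k : nat | (1 <= k <= i)%N]].

Definition partial_sum1 (R : realType) (b : nat -> R) (m : nat) : R :=
  (\sum_(1 <= k < m.+1) b k)%R.

Section inequalities.
Variables (R : realType) (p q : R) (a b u : nat -> R).
Local Notation B := (partial_sum1 b).

Definition ineq_monotone (C : R) : Prop :=
  forall x : nat -> R, nonneg_seq1 x -> nonincreasing_seq1 x ->
  (\sum_(1 <= m <oo)
     (sup_from m (fun i => (u i)%:E * \sum_(1 <= k < i.+1) (x k)%:E)) `^ q
     * (a m)%:E) `^ q^-1
  <= C%:E * (\sum_(1 <= m <oo) (x m `^ p * b m)%:E) `^ p^-1.

Definition ineq_sum_tail (D : R) : Prop :=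
  forall y : nat -> R, nonneg_seq1 y ->
  (\sum_(1 <= m <oo)
     (sup_from m (fun i => (u i)%:E *
        \sum_(1 <= k < i.+1) (\sum_(k <= j <oo) (y j)%:E) `^ p^-1)) `^ q
     * (a m)%:E) `^ q^-1
  <= D%:E * (\sum_(1 <= m <oo) (y m * B m)%:E) `^ p^-1.

Definition ineq_weighted_sum_tail (D : R) : Prop :=
  forall y : nat -> R, nonneg_seq1 y ->
  (\sum_(1 <= m <oo)
     (sup_from m (fun i => (u i `^ p)%:E *
        \sum_(1 <= k < i.+1)
          ((k%:R `^ (p - 1))%:E * \sum_(k <= j <oo) (y j)%:E))) `^ (q / p)
     * (a m)%:E) `^ q^-1
  <= D%:E * (\sum_(1 <= m <oo) (y m * B m)%:E) `^ p^-1.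

Definition ineq_sup_tail (D : R) : Prop :=
  forall y : nat -> R, nonneg_seq1 y ->
  (\sum_(1 <= m <oo)
     (sup_from m (fun i => (u i `^ p)%:E *
        sup_upto i (fun k =>
          (k%:R `^ p)%:E * \sum_(k <= j <oo) (y j)%:E))) `^ (q / p)
     * (a m)%:E) `^ q^-1
  <= D%:E * (\sum_(1 <= m <oo) (y m * B m)%:E) `^ p^-1.

Definition ineq_sum_sup (D : R) : Prop :=
  forall y : nat -> R, nonneg_seq1 y ->
  (\sum_(1 <= m <oo)
     (sup_from m (fun i => (u i)%:E *
        \sum_(1 <= k < i.+1) (sup_from k (fun j => (y j)%:E)) `^ p^-1)) `^ q
     * (a m)%:E) `^ q^-1
  <= D%:E * (\sum_(1 <= m <oo) (y m * B m)%:E) `^ p^-1.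

Definition ineq_sup_sup (D : R) : Prop :=
  forall y : nat -> R, nonneg_seq1 y ->
  (\sum_(1 <= m <oo)
     (sup_from m (fun i => (u i `^ p)%:E *
        sup_upto i (fun k =>
          (k%:R `^ p)%:E * sup_from k (fun j => (y j)%:E)))) `^ (q / p)
     * (a m)%:E) `^ q^-1
  <= D%:E * (\sum_(1 <= m <oo) (y m * B m)%:E) `^ p^-1.

End inequalities.

Definition holds_with_finite_constant (R : realType) (I : R -> Prop) : Prop :=
  exists C : R, (0 <= C)%R /\ I C.

(* Equal to +oo when no constant is admissible, since ereal_inf set0 = +oo. *)
Definition best_constant (R : realType) (I : R -> Prop) : \bar R :=
  ereal_inf [set C%:E | C in [set C : R | (0 <= C)%R /\ I C]].

Definition equiv_up_to (R : realType) (c : R) (X Y : \bar R) : Prop :=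
  (c^-1)%:E * Y <= X /\ X <= c%:E * Y.

(* Main.v *)
Require Import Defs.
From HB Require Import structures.
From mathcomp Require Import all_boot all_order all_algebra.
From mathcomp Require Import all_classical all_reals all_analysis.
From mathcomp Require Import ring lra zify.

(** Up to truncation, [x^p] is the sequence of tail sums of some [y], so (i) is (ii);
  [(sum f)^p <= sum k^(p-1) f(k)^p] for non-increasing [f] gives (iii) => (ii), while
  (ii) => (iv), (ii) => (v), (iv) => (vi), (v) => (vi) are pointwise.  The crux is
  (vi) => (iii).

  There the sum in (iii) is comparable to [phi(i) = sum_j min(i,j)^p y(j)], and it
  suffices to find [z] with [phi(i) <= c max_j min(i,j)^p z(j)] for all [i] and
  [sum z B <= c sum y B].  Choose positions [n_0 < n_1 < ...] greedily so that from
  one to the next [phi(n)] grows and [phi(n)/n^p] decays by a factor 4.  Then half of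
  [phi(n_k)] comes from the [j] strictly between [n_(k-1)] and [n_(k+1)], and a single
  mass at the cheapest such position reproduces [n_k] at a cost of at most twice the
  part of [sum y B] carried by that range; each [j] lies in at most two ranges. *)

Set Implicit Arguments.
Unset Strict Implicit.
Unset Printing Implicit Defensive.

Import Order.TTheory GRing.Theory Num.Theory.
Import numFieldNormedType.Exports.

Local Open Scope classical_set_scope.
Local Open Scope ring_scope.

(** * Replacing a finite sequence by a sparse one *)

(** The quotient [min t c / t] is non-increasing in [t]; the inequality is cleared of
    denominators. *)
Lemma min_quasiconcave (R : realDomainType) (a b c : R) : 0 <= b -> 0 <= c -> b <= a ->
  Num.min a c * b <= Num.min b c * a.
Proof.
move=> b0 c0 ba; have [bc|/ltW cb] := leP b c.
  by rewrite [leRHS]mulrC ler_wpM2r// ge_min lexx.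
by rewrite min_r ?(le_trans cb)// ler_wpM2l.
Qed.

(** One factor is at most [b], and the other at most the smaller of [a] and [c]. With [b = w n] this
    lets a mass placed for [n] act at any other position. *)
Lemma min_mul_min_le (R : realDomainType) (a b c : R) : 0 <= a -> 0 <= b -> 0 <= c ->
  Num.min a b * Num.min b c <= b * Num.min a c.
Proof.
move=> a0 b0 c0; case: (leP a c) => _; first rewrite [leRHS]mulrC;
  by apply: ler_pM; rewrite ?le_min ?ge_min ?a0 ?b0 ?c0 ?lexx ?orbT.
Qed.

Section discretization.
Variables (R : realFieldType) (w y B : nat -> R) (N : nat).
Hypothesis w_gt0 : forall j, (1 <= j)%N -> 0 < w j.
Hypothesis w_nd : forall i j, (1 <= i)%N -> (i <= j)%N -> w i <= w j.
Hypothesis w_doubling : forall j, (1 <= j)%N -> w j.+1 <= 2 * w j.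
Hypothesis y_ge0 : forall j, (1 <= j)%N -> 0 <= y j.
Hypothesis B_ge0 : forall j, (1 <= j)%N -> 0 <= B j.

Local Notation minw i j := (Num.min (w i) (w j)).

(** For [w j = j^p] this bounds, up to the factor [1/p], the weighted sum of tails in (iii) with [y]
    cut off after [N]. As a combination of the functions [min (w i) (w j)] of [i], it is
    non-decreasing while its quotient by [w] is non-increasing. *)
Definition fundamental_fun (i : nat) : R :=
  \sum_(1 <= j < N.+1) minw i j * y j.
Local Notation phi := fundamental_fun.

Lemma minw_gt0 i j : (1 <= i)%N -> (1 <= j)%N -> 0 < minw i j.
Proof. by move=> i1 j1; rewrite lt_min !w_gt0. Qed.

Lemma sum_nat_ge0 (f : nat -> R) m n : (1 <= m)%N ->
  (forall j, (1 <= j)%N -> 0 <= f j) -> 0 <= \sum_(m <= j < n) f j.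
Proof.
move=> m1 f0; rewrite big_nat_cond sumr_ge0// => j /andP[/andP[mj _] _].
by rewrite f0// (leq_trans m1).
Qed.

Lemma fundamental_fun_ge0 i : (1 <= i)%N -> 0 <= phi i.
Proof.
move=> i1; apply: sum_nat_ge0 => // j j1.
by rewrite mulr_ge0 ?y_ge0// ltW// minw_gt0.
Qed.

Lemma fundamental_fun_nd i n : (1 <= i)%N -> (i <= n)%N -> phi i <= phi n.
Proof.
move=> i1 le_in; rewrite /phi; apply: ler_sum_nat => j /andP[j1 _].
by rewrite ler_wpM2r ?y_ge0// le_min !ge_min lexx orbT w_nd.
Qed.

Lemma fundamental_fun_quasiconcave i n : (1 <= n)%N -> (n <= i)%N ->
  phi i * w n <= phi n * w i.
Proof.
move=> n1 le_ni; rewrite /phi !mulr_suml; apply: ler_sum_nat => j /andP[j1 _].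
rewrite !(mulrAC _ (y j)) ler_wpM2r ?y_ge0//.
by rewrite min_quasiconcave ?w_nd ?ltW ?w_gt0.
Qed.

(* Among the positions carrying half of [phi n], the mass reproducing [n] is put
   where it is cheapest: [j] minimizes [B j / minw n j]. *)
Lemma cheapest_position p n r : (p < n < r)%N ->
  phi n <= 2 * \sum_(p.+1 <= j < r) minw n j * y j ->
  exists j c, [/\ (p < j < r)%N, 0 <= c,
    c * B j <= 2 * \sum_(p.+1 <= j < r) y j * B j &
    forall i, (1 <= i)%N -> phi n * minw i n <= w n * (c * minw i j)].
Proof.
move=> /andP[pn nr] half.
have n1 : (1 <= n)%N by exact: leq_trans pn.
have [j /andP[pj jr] jmin] : exists2 j, (p < j < r)%N &
    forall k, (p < k < r)%N -> B j / minw n j <= B k / minw n k.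
  pose P := [pred k : 'I_r | (p < k)%N].
  have Pn : P (Ordinal nr) by [].
  case: (Order.TotalTheory.arg_minP (fun k : 'I_r => B k / minw n k) Pn) => j Pj jmin.
  exists j; first by rewrite [(p < j)%N]Pj ltn_ord.
  by move=> k /andP[pk kr]; exact: (jmin (Ordinal kr)).
have j1 : (1 <= j)%N by exact: leq_trans pj.
have mnj := minw_gt0 n1 j1; have phi0 := fundamental_fun_ge0 n1.
(* This mass is chosen so that [c * minw n j] is exactly [phi n]. *)
exists j, (phi n / minw n j); split; first by rewrite pj.
- by rewrite divr_ge0// ltW.
- rewrite mulrAC -mulrA.
  apply: (@le_trans _ _
      ((2 * \sum_(p.+1 <= k < r) minw n k * y k) * (B j / minw n j))).
    by rewrite ler_wpM2r// divr_ge0 ?B_ge0// ltW.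
  rewrite -mulrA ler_wpM2l// mulr_suml; apply: ler_sum_nat => k /andP[pk kr].
  have k1 : (1 <= k)%N by exact: leq_trans pk.
  rewrite mulrAC mulrC ler_wpM2l ?y_ge0//.
  rewrite mulrC -ler_pdivlMr ?minw_gt0//.
  by apply: jmin; rewrite pk.
- move=> i i1; rewrite mulrA -(ler_pM2r mnj).
  have -> : w n * (phi n / minw n j) * minw i j * minw n j = phi n * (w n * minw i j).
    by field; rewrite gt_eqF.
  rewrite -mulrA ler_wpM2l//.
  by rewrite min_mul_min_le ?ltW ?w_gt0.
Qed.

(** The function [phi n * minw i n / w n] of [i] is the smallest one that equals [phi n] at [n], is
    non-decreasing and has a non-increasing quotient by [w]. One mass of [z] has to dominate it
    everywhere. *)
Definition reproduces (z : nat -> R) (n : nat) : Prop :=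
  exists2 j, (1 <= j <= N)%N &
  forall i, (1 <= i)%N -> phi n * minw i n <= w n * (z j * minw i j).

(** The 8 is the greedy factor 4 times the doubling constant 2 of [w]. *)
Definition covers (z : nat -> R) (i : nat) : Prop :=
  exists2 j, (1 <= j <= N)%N & phi i <= 8 * (z j * minw i j).

Lemma reproduces_covers z i n : (1 <= i)%N -> (1 <= n)%N -> reproduces z n ->
  phi i * w n <= 8 * (phi n * minw i n) -> covers z i.
Proof.
move=> i1 n1 [j jN rep] le8; exists j => //.
rewrite -(ler_pM2r (w_gt0 n1)); apply: (le_trans le8).
by rewrite -mulrA ler_wpM2l// [leRHS]mulrC rep.
Qed.

Lemma reproduces_nd z z' n : (1 <= n)%N -> (forall j, z j <= z' j) ->
  reproduces z n -> reproduces z' n.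
Proof.
move=> n1 zz' [j /andP[j1 jN] rep]; exists j; first by rewrite j1.
move=> i i1; apply: (le_trans (rep i i1)).
by rewrite ler_wpM2l ?(ltW (w_gt0 n1))// ler_wpM2r// ltW// minw_gt0.
Qed.

Lemma covers_nd z z' i : (1 <= i)%N -> (forall j, z j <= z' j) ->
  covers z i -> covers z' i.
Proof.
move=> i1 zz' [j /andP[j1 jN] cov]; exists j; first by rewrite j1.
apply: (le_trans cov).
by rewrite ler_wpM2l// ler_wpM2r// ltW// minw_gt0.
Qed.

Definition supported (z : nat -> R) : Prop :=
  (forall j, 0 <= z j) /\ (forall j, ~~ (1 <= j <= N)%N -> z j = 0).

Lemma add_point z n p r : (p < n < r)%N -> (r <= N.+1)%N ->
  phi n <= 2 * \sum_(p.+1 <= j < r) minw n j * y j ->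
  supported z ->
  exists z', [/\ supported z', forall j, z j <= z' j, reproduces z' n &
    \sum_(1 <= j < N.+1) z' j * B j <=
    2 * \sum_(p.+1 <= j < r) y j * B j + \sum_(1 <= j < N.+1) z j * B j].
Proof.
move=> pnr rN half [z0 zS].
have [j [c [/andP[pj jr] c0 cB rep]]] := cheapest_position pnr half.
have j1 : (1 <= j)%N by exact: leq_trans pj.
have jN : (j <= N)%N by rewrite -ltnS (leq_trans jr).
(* The mass is added to [z], which may already be positive at [j]; so whatever [z] reproduces or
   covers is kept. *)
exists (fun k => c * (k == j)%:R + z k); split.
- split=> k; first by rewrite addr_ge0// mulr_ge0// ler0n.
  move=> kN; rewrite zS// addr0; case: eqVneq kN => [->|]; last by rewrite mulr0.
  by rewrite j1 jN.
- by move=> k; rewrite lerDr mulr_ge0// ler0n.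
- exists j; first by rewrite j1.
  move=> i i1; apply: (le_trans (rep i i1)).
  have n1 : (1 <= n)%N by case/andP: pnr => pn _; exact: leq_trans pn.
  rewrite ler_wpM2l ?(ltW (w_gt0 n1))//.
  by rewrite ler_wpM2r ?(ltW (minw_gt0 _ _))// eqxx mulr1 lerDl.
- under eq_bigr do rewrite mulrDl.
  rewrite big_split/= lerD2r (le_trans _ cB)//.
  rewrite (big_rem j) ?mem_index_iota ?j1//= eqxx mulr1 big1_seq ?addr0// => k /andP[_].
  rewrite mem_rem_uniq ?iota_uniq// inE => /andP[/negPf -> _].
  by rewrite mulr0 mul0r.
Qed.

(** For [j <= n <= r] both minima equal [w j]. Hence once [phi] has grown by a factor 4 from [n] to
    [r], the indices up to [n] carry at most a quarter of [phi r]. *)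
Lemma sum_head_le p n r : (p <= n)%N -> (n <= r)%N -> (r <= N)%N -> (1 <= n)%N ->
  \sum_(1 <= j < p.+1) minw r j * y j <= phi n.
Proof.
move=> pn nr rN n1.
rewrite /phi (@big_cat_nat _ _ _ p.+1 1 N.+1)//=; last by lia.
rewrite -[leLHS]addr0 lerD//; last first.
  by apply: sum_nat_ge0 => // j j1; rewrite mulr_ge0 ?y_ge0// ltW// minw_gt0.
apply: ler_sum_nat => j /andP[j1 jp].
rewrite ler_wpM2r ?y_ge0//.
have wjn : w j <= w n by apply: w_nd => //; lia.
by rewrite le_min ge_min wjn ge_min lexx !orbT.
Qed.

(** For [j >= r] the minima are [w n] and [w r], so the tail of [phi n] is [w n / w r] times that of
    [phi r]. Decay of [phi / w] by a factor 4 makes it at most a quarter of [phi n]. *)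
Lemma sum_tail_le n r : (1 <= n <= r)%N -> (r <= N.+1)%N ->
  w r * \sum_(r <= j < N.+1) minw n j * y j <= phi r * w n.
Proof.
move=> /andP[n1 nr] rN; have r1 : (1 <= r)%N by exact: leq_trans nr.
rewrite /phi (@big_cat_nat _ _ _ r 1 N.+1)//= mulrDl -[leLHS]add0r lerD//.
  rewrite mulr_ge0 ?(ltW (w_gt0 n1))//.
  by apply: sum_nat_ge0 => // j j1; rewrite mulr_ge0 ?y_ge0// ltW// minw_gt0.
rewrite mulr_sumr mulr_suml; apply: ler_sum_nat => j /andP[rj _].
have j1 : (1 <= j)%N by exact: leq_trans rj.
have /min_idPl -> : w r <= w j by exact: w_nd.
have /min_idPl -> : w n <= w j by apply: w_nd => //; lia.
by rewrite mulrAC mulrA.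
Qed.

(** Head and tail each carry at most a quarter of [phi n]. The value [r = N.+1] stands for the
    absence of a next position: the tail is then empty. *)
Lemma half_middle p n r : (p < n < r)%N -> (r <= N.+1)%N ->
  4 * \sum_(1 <= j < p.+1) minw n j * y j <= phi n ->
  (r = N.+1 \/ 4 * (phi r * w n) <= phi n * w r) ->
  phi n <= 2 * \sum_(p.+1 <= j < r) minw n j * y j.
Proof.
move=> /andP[pn nr] rN left right.
have n1 : (1 <= n)%N by exact: leq_trans pn.
have r1 : (1 <= r)%N by lia.
have tail : 4 * \sum_(r <= j < N.+1) minw n j * y j <= phi n.
  case: right => [->|right].
    by rewrite big_geq// mulr0 fundamental_fun_ge0.
  have nr1 : (1 <= n <= r)%N by lia.
  have := sum_tail_le nr1 rN; have := w_gt0 r1.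
  by move=> wr tl; rewrite -(ler_pM2r wr); lra.
have phiE : phi n = \sum_(1 <= j < p.+1) minw n j * y j +
    \sum_(p.+1 <= j < r) minw n j * y j + \sum_(r <= j < N.+1) minw n j * y j.
  rewrite -addrA -(@big_cat_nat _ _ _ r)//=; last by lia.
  by rewrite -(@big_cat_nat _ _ _ p.+1)//; lia.
by rewrite {1}phiE in tail; rewrite {1}phiE; rewrite phiE in left tail *; lra.
Qed.

(* [r] is the first position after [n] at which [phi] has grown and [phi / w] has
   decayed by a factor 4; by doubling, everything in between is covered by [n] or [r]. *)
Lemma covers_between z n r i : (1 <= n <= i)%N -> (i < r)%N ->
  phi r.-1 <= 4 * phi n \/ phi n * w r.-1 <= 4 * (phi r.-1 * w n) ->
  reproduces z n -> reproduces z r -> covers z i.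
Proof.
move=> /andP[n1 ni] ir [up|down] repn repr.
  (* [phi] has grown by at most 4 up to [r.-1], hence up to [i], so the mass for [n] suffices. *)
  apply: (reproduces_covers _ n1 repn); first exact: leq_trans ni.
  rewrite min_r ?w_nd// mulrA ler_wpM2r ?(ltW (w_gt0 n1))//.
  have le1 : phi i <= phi r.-1 by apply: fundamental_fun_nd; lia.
  by have := fundamental_fun_ge0 n1; lra.
have [i1 r1 r11 ir1] : [/\ (1 <= i)%N, (1 <= r)%N, (1 <= r.-1)%N & (i <= r.-1)%N].
  by split; lia.
apply: (reproduces_covers i1 r1 repr).
rewrite min_l ?w_nd ?(ltnW ir)//.
rewrite -(ler_pM2r (w_gt0 n1)).
have q := fundamental_fun_quasiconcave n1 ni.
(* The bound on the decay is known at [r.-1], but the reproduced position is [r]; doubling bridges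
   the gap. *)
have wr : w r <= 2 * w r.-1 by have := w_doubling r11; rewrite prednK.
have le1 : phi r.-1 <= phi r by apply: fundamental_fun_nd; lia.
have := w_gt0 n1; have := w_gt0 i1; have := w_gt0 r11.
have := fundamental_fun_ge0 i1; have := fundamental_fun_ge0 n1 => pn pi wr1 wi wn.
have h1 : phi i * w n * w r <= phi i * w n * (2 * w r.-1).
  by rewrite ler_wpM2l// mulr_ge0// ltW.
have h2 : phi i * w n * w r.-1 <= phi n * w i * w r.-1.
  by rewrite ler_wpM2r// ltW.
have h3 : phi n * w r.-1 * w i <= 4 * (phi r.-1 * w n) * w i.
  by rewrite ler_wpM2r// ltW.
have h4 : phi r.-1 * (w n * w i) <= phi r * (w n * w i).
  by rewrite ler_wpM2r// mulr_ge0// ltW.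
lra.
Qed.

(** Here [n] is the current position, [p] the previous one, and [d] bounds the remaining length for
    the induction. In the cost, an index in [(p, n]] lies only in the range of [n] and counts twice;
    a later index lies in at most two ranges and counts at most four times. *)
Lemma greedy_cover d n p : (N - n < d)%N -> (p < n <= N)%N ->
  4 * \sum_(1 <= j < p.+1) minw n j * y j <= phi n ->
  exists z, [/\ supported z, reproduces z n,
    forall i, (n <= i <= N)%N -> covers z i &
    \sum_(1 <= j < N.+1) z j * B j <=
    2 * \sum_(p.+1 <= j < n.+1) y j * B j + 4 * \sum_(n.+1 <= j < N.+1) y j * B j].
Proof.
elim: d n p => // d IH n p nd /andP[pn nN] left.
have n1 : (1 <= n)%N by exact: leq_trans pn.
have yB0 j : (1 <= j)%N -> 0 <= y j * B j by move=> j1; rewrite mulr_ge0 ?y_ge0 ?B_ge0.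
have supp0 : supported (fun=> 0) by [].
pose P r := [&& (n < r)%N, (r <= N)%N, 4 * phi n <= phi r & 4 * (phi r * w n) <= phi n * w r].
have [exP|noP] := boolP [exists r : 'I_N.+1, P r]; last first.
  have NP r : ~~ P r.
    apply/negP => Pr; have rN : (r < N.+1)%N by case/and4P: Pr.
    by case/existsP: noP; exists (Ordinal rN).
  have nN1 : (p < n < N.+1)%N by rewrite pn ltnS.
  have halfn := half_middle nN1 (leqnn _) left (or_introl erefl).
  have [z [Sz _ repn costz]] := add_point nN1 (leqnn _) halfn supp0.
  rewrite [X in _ + X]big1 ?addr0 in costz; last by move=> j _; rewrite mul0r.
  (* There is no next position. Either [phi] stays within a factor 4 of [phi n] and [n] covers the
     rest, or [N] is added as a last position. *)
  have [up|up] := leP (phi N) (4 * phi n).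
    exists z; split => //.
      move=> i /andP[ni iN]; apply: (reproduces_covers _ n1 repn); first exact: leq_trans ni.
      rewrite min_r ?w_nd// mulrA ler_wpM2r ?(ltW (w_gt0 n1))//.
      have le1 : phi i <= phi N by apply: fundamental_fun_nd => //; exact: leq_trans ni.
      by have := fundamental_fun_ge0 n1; lra.
    apply: (le_trans costz).
    rewrite (@big_cat_nat _ _ _ n.+1 p.+1)//=; last by rewrite ltnW.
    have := sum_nat_ge0 N.+1 (ltn0Sn n) yB0; lra.
  have ltnN : (n < N)%N.
    rewrite ltn_neqAle nN andbT; apply/eqP => nE; move: up; rewrite -nE.
    by have := fundamental_fun_ge0 n1; lra.
  have N1 : (1 <= N)%N by exact: leq_trans nN.
  have nNN1 : (n < N < N.+1)%N by rewrite ltnN leqnn.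
  have leftN : 4 * \sum_(1 <= j < n.+1) minw N j * y j <= phi N.
    by have := sum_head_le (leqnn n) (ltnW ltnN) (leqnn N) n1; lra.
  have halfN := half_middle nNN1 (leqnn _) leftN (or_introl erefl).
  have [z' [Sz' zz' repN costz']] := add_point nNN1 (leqnn _) halfN Sz.
  have repn' := reproduces_nd n1 zz' repn.
  exists z'; split => //.
    move=> i /andP[ni iN]; have i1 : (1 <= i)%N by exact: leq_trans ni.
    (* [N] fails [P] although [phi] has grown enough there, so it is the decay that fails. *)
    have down : phi n * w N < 4 * (phi N * w n).
      by have := NP N; rewrite /P ltnN leqnn (ltW up)/= -ltNge.
    apply: (reproduces_covers i1 N1 repN).
    rewrite min_l ?w_nd// -(ler_pM2r (w_gt0 n1)).
    have q := fundamental_fun_quasiconcave n1 ni.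
    have h1 : phi i * w n * w N <= phi n * w i * w N by rewrite ler_wpM2r// ltW ?w_gt0.
    have h2 : phi n * w N * w i <= 4 * (phi N * w n) * w i.
      by rewrite ler_wpM2r ?(ltW (w_gt0 i1))// ltW.
    have h3 : 0 <= phi N * w n * w i.
      by rewrite !mulr_ge0 ?fundamental_fun_ge0// ltW ?w_gt0.
    lra.
  apply: (le_trans costz'); move: costz.
  rewrite (@big_cat_nat _ _ _ n.+1 p.+1)//=; last by rewrite ltnW.
  lra.
have exN : exists r, P r by case/existsP: exP => r Pr; exists r.
case: (ex_minnP exN) => r /and4P[nr rN up down] rmin.
have r1 : (1 <= r)%N by exact: leq_trans nr.
have leftr : 4 * \sum_(1 <= j < n.+1) minw r j * y j <= phi r.
  by have := sum_head_le (leqnn n) (ltnW nr) rN n1; lra.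
have [||z [Sz repr covz costz]] := IH r n _ _ leftr; [lia|by rewrite nr|].
have pnr : (p < n < r)%N by rewrite pn.
have half := half_middle pnr (leqW rN) left (or_intror down).
have [z' [Sz' zz' repn costz']] := add_point pnr (leqW rN) half Sz.
exists z'; split => //.
  move=> i /andP[ni iN]; have i1 : (1 <= i)%N by exact: leq_trans ni.
  have [ri|ir] := leqP r i; first by apply: (covers_nd i1 zz'); apply: covz; rewrite ri.
  have nni : (1 <= n <= i)%N by rewrite n1.
  apply: (covers_between nni ir _ repn (reproduces_nd r1 zz' repr)).
  have [u|u] := leP (phi r.-1) (4 * phi n); first by left.
  (* If [r.-1 = n], growth beyond a factor 4 is absurd; otherwise minimality of [r] denies [P r.-1],
     so the decay falls short there. *)
  right; have [ltn_r1|] := ltnP n r.-1; last first.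
    move=> le_r1; have E : r.-1 = n by apply/eqP; rewrite eqn_leq le_r1 -ltnS prednK.
    by move: u; rewrite E; have := fundamental_fun_ge0 n1; lra.
  rewrite ltW// ltNge; apply/negP => dn.
  have : P r.-1 by rewrite /P ltn_r1 (leq_trans (leq_pred r) rN) (ltW u) dn.
  by move=> /rmin; rewrite leqNgt ltn_predL r1.
apply: (le_trans costz'); move: costz.
(* The new range [(p, r)] and the range [(n, r]] charged by the recursion overlap exactly on
   [(n, r)], which accounts for the coefficient 4. *)
have catp : \sum_(p.+1 <= j < r) y j * B j =
    \sum_(p.+1 <= j < n.+1) y j * B j + \sum_(n.+1 <= j < r) y j * B j.
  by rewrite -(@big_cat_nat _ _ _ n.+1)//=; lia.
have catn : \sum_(n.+1 <= j < N.+1) y j * B j =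
    \sum_(n.+1 <= j < r.+1) y j * B j + \sum_(r.+1 <= j < N.+1) y j * B j.
  by rewrite -(@big_cat_nat _ _ _ r.+1)//=; lia.
have recr : \sum_(n.+1 <= j < r.+1) y j * B j =
    \sum_(n.+1 <= j < r) y j * B j + y r * B r by rewrite big_nat_recr.
have := yB0 r r1; lra.
Qed.

(** The greedy choice starts at [n = 1] with [p = 0], where the head is empty. *)
Lemma sparse_majorant : exists z, [/\ supported z,
  forall i, (1 <= i)%N -> exists2 j, (1 <= j)%N & phi i <= 8 * (z j * minw i j) &
  \sum_(1 <= j < N.+1) z j * B j <= 4 * \sum_(1 <= j < N.+1) y j * B j].
Proof.
case: (posnP N) => [N0|N1].
  exists (fun=> 0); split=> [|i i1|]; first by [].
    by exists 1%N => //; rewrite mul0r mulr0 /phi N0 big_geq.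
  by rewrite N0 !big_geq// mulr0.
have [|||z [Sz _ cov cost]] := @greedy_cover N.+1 1 0 _ _ _.
- lia.
- by rewrite N1.
- by rewrite big_geq// mulr0 fundamental_fun_ge0.
exists z; split=> //; last first.
  apply: (le_trans cost).
  rewrite [in leRHS]big_ltn// big_nat1.
  have : 0 <= y 1%N * B 1%N by rewrite mulr_ge0 ?y_ge0 ?B_ge0.
  lra.
move=> i i1; have [iN|/ltnW Ni] := leqP i N.
  have [|j /andP[j1 _] le8] := cov i; first by rewrite i1.
  by exists j.
(* Beyond [N] nothing changes: all masses sit at indices [k <= N], where
   [minw i k = minw N k = w k]. *)
have [|j /andP[j1 jN] le8] := cov N; first by rewrite N1 leqnn.
exists j => //.
have wjN : w j <= w N by exact: w_nd.
have wji : w j <= w i by apply: w_nd => //; exact: leq_trans Ni.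
rewrite min_r// in le8; rewrite min_r//; apply: le_trans le8.
rewrite /phi; apply: ler_sum_nat => k /andP[k1 kN].
rewrite ler_wpM2r ?y_ge0//.
by rewrite [leRHS]min_r ?ge_min ?lexx ?orbT// w_nd.
Qed.
End discretization.

(** * Sums of real powers *)

Section powR_sums.
Variables (R : realType) (p : R).
Hypotheses (p_gt0 : 0 < p) (p_le1 : p <= 1).

(** A concave power lies below its tangent at 1. Applying [1 + t <= expR t] to [s / s^p] and to
    [1 / s^p] and averaging with weights [p] and [1 - p] cancels the logarithms. *)
Lemma powR_le_tangent (s : R) : 0 <= s -> s `^ p <= 1 + p * (s - 1).
Proof.
rewrite le_eqVlt => /predU1P[<-|s0].
  by rewrite powR0 ?gt_eqF// sub0r mulrN1 subr_ge0.
rewrite /powR gt_eqF//; set E := expR _.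
have E0 : 0 <= E by exact: expR_ge0.
have sE : s = E * expR ((1 - p) * ln s).
  by rewrite -expRD -mulrDl addrC subrK mul1r lnK.
have oneE : 1 = E * expR (- (p * ln s)) by rewrite -expRD subrr expR0.
have h1 : E * (1 + (1 - p) * ln s) <= s.
  by rewrite [leRHS]sE ler_wpM2l// expR_ge1Dx.
have h2 : E * (1 + - (p * ln s)) <= 1.
  by rewrite [leRHS]oneE ler_wpM2l// expR_ge1Dx.
have h3 : p * (E * (1 + (1 - p) * ln s)) <= p * s by rewrite ler_wpM2l// ltW.
have h4 : (1 - p) * (E * (1 + - (p * ln s))) <= (1 - p) * 1.
  by rewrite ler_wpM2l// subr_ge0.
lra.
Qed.

Lemma natr_powR_gt0 (j : nat) : (1 <= j)%N -> 0 < j%:R `^ p :> R.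
Proof. by move=> j1; rewrite powR_gt0// ltr0n. Qed.

Lemma natr_powR_nd (i j : nat) : (i <= j)%N -> i%:R `^ p <= j%:R `^ p :> R.
Proof.
by move=> ij; rewrite ge0_ler_powR ?nnegrE ?ler0n ?ler_nat// ltW.
Qed.

Lemma natr_powR_doubling (j : nat) : (1 <= j)%N ->
  j.+1%:R `^ p <= 2 * j%:R `^ p :> R.
Proof.
move=> j1; apply: (@le_trans _ _ ((2 * j)%:R `^ p)); first by rewrite natr_powR_nd//; lia.
rewrite natrM powRM ?ler0n// ler_wpM2r ?powR_ge0//.
by rewrite ler1_powR// ler1n.
Qed.

(** Induction; the step is the tangent bound at [s = n / (n + 1)], which gives
    [n^p <= (n+1)^p - p (n+1)^(p-1)]. *)
Lemma sum_powR_le (n : nat) :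
  \sum_(1 <= k < n.+1) k%:R `^ (p - 1) <= p^-1 * n%:R `^ p :> R.
Proof.
elim: n => [|n IH]; first by rewrite big_geq// mulr_ge0 ?powR_ge0// invr_ge0 ltW.
rewrite big_nat_recr//=; apply: (le_trans (lerD IH (lexx _))).
have n0 : 0 < n.+1%:R :> R by rewrite ltr0n.
have nE : n%:R = n.+1%:R * (1 - n.+1%:R^-1) :> R.
  by rewrite mulrBr mulr1 divff ?gt_eqF// -natr1 addrK.
have s0 : 0 <= 1 - n.+1%:R^-1 :> R by rewrite subr_ge0 invf_le1// ler1n.
rewrite -(ler_pM2l p_gt0) mulrDr !mulrA divff ?gt_eqF// !mul1r.
have := ler_wpM2l (powR_ge0 n.+1%:R p) (powR_le_tangent s0).
rewrite -powRM// -nE -[n.+1%:R `^ p]mulr_powRB1 ?(ltW n0)// => h.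
apply: (le_trans (lerD h (lexx _))).
rewrite le_eqVlt; apply/orP; left; apply/eqP.
by field; rewrite gt_eqF.
Qed.

(** Split [T^p = T^(p-1) S + T^(p-1) f] for [T = S + f]. As [p - 1 <= 0], the bounds [T >= S] and
    [T >= i f] estimate the two terms. *)
Lemma powR_add_le (i : nat) (S f : R) : (1 <= i)%N -> 0 <= f -> i.-1%:R * f <= S ->
  (S + f) `^ p <= S `^ p + i%:R `^ (p - 1) * f `^ p.
Proof.
move=> i1; rewrite le_eqVlt => /predU1P[<- _|f0 iS].
  by rewrite addr0 lerDl mulr_ge0 ?powR_ge0.
have S0 : 0 <= S by rewrite (le_trans _ iS)// mulr_ge0// ltW.
have i0 : 0 < i%:R :> R by rewrite ltr0n.
set T := S + f.
have ifT : i%:R * f <= T.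
  by rewrite -(prednK i1) -natr1 mulrDl mul1r lerD2r.
have T0 : 0 < T by rewrite ltr_wpDl.
have h1 : T `^ (p - 1) * S <= S `^ p.
  have -> : S = T * (S / T) by field; rewrite gt_eqF.
  rewrite powRM ?divr_ge0 ?(ltW T0)// -[T `^ p]mulr_powRB1 ?(ltW T0)//.
  rewrite mulrA [_ * T]mulrC ler_wpM2l ?mulr_ge0 ?powR_ge0 ?(ltW T0)//.
  move: S0; rewrite le_eqVlt => /predU1P[<-|S0].
    by rewrite mul0r powR_ge0.
  rewrite ger1_powR// divr_gt0//= ler_pdivrMr// mul1r.
  by rewrite lerDl ltW.
have h2 : T `^ (p - 1) * f <= i%:R `^ (p - 1) * f `^ p.
  rewrite -[f `^ p]mulr_powRB1 ?(ltW f0)// mulrCA mulrC ler_wpM2l ?(ltW f0)//.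
  rewrite -powRM ?(ltW f0) ?(ltW i0)//.
  rewrite -opprB !powRN lef_pV2 ?posrE ?powR_gt0 ?mulr_gt0//.
  by rewrite ge0_ler_powR ?subr_ge0 ?nnegrE ?mulr_ge0 ?(ltW i0) ?(ltW f0) ?(ltW T0).
have <- : T `^ (p - 1) * T = T `^ p by rewrite mulrC mulr_powRB1// ltW.
by rewrite {2}/T mulrDr lerD.
Qed.

Lemma nonincreasing_sum_ge (f : nat -> R) (n k : nat) :
  (forall i j, (1 <= i)%N -> (i <= j)%N -> f j <= f i) ->
  (k <= n)%N -> k%:R * f n <= \sum_(1 <= j < k.+1) f j.
Proof.
move=> fni kn; have -> : k%:R * f n = \sum_(1 <= j < k.+1) f n.
  by rewrite sumr_const_nat subSS subn0 mulr_natl.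
by apply: ler_sum_nat => j /andP[j1 jk]; apply: fni => //; lia.
Qed.

(** Terms are added one at a time; monotonicity makes each new term at most the mean of the earlier
    ones, as [powR_add_le] requires. *)
Lemma powR_sum_le (f : nat -> R) (n : nat) :
  (forall j, (1 <= j)%N -> 0 <= f j) ->
  (forall i j, (1 <= i)%N -> (i <= j)%N -> f j <= f i) ->
  (\sum_(1 <= k < n.+1) f k) `^ p <=
  \sum_(1 <= k < n.+1) k%:R `^ (p - 1) * f k `^ p.
Proof.
move=> f0 fni; elim: n => [|n IH]; first by rewrite !big_geq// powR0 ?gt_eqF.
rewrite [in leLHS]big_nat_recr// [in leRHS]big_nat_recr//=.
have := powR_add_le (ltn0Sn n) (f0 _ (ltn0Sn n)) (nonincreasing_sum_ge fni (leqnSn n)).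
by move=> /le_trans; apply; rewrite lerD2r.
Qed.

(** After exchanging the sums, [y j] has as coefficient the sum of [k^(p-1)] over [k <= min(i, j)],
    which is bounded by its full versions up to [i] and up to [j]. *)
Lemma weighted_tail_sum_le (y : nat -> R) (N i : nat) :
  (forall j, (1 <= j)%N -> 0 <= y j) ->
  \sum_(1 <= k < i.+1) k%:R `^ (p - 1) * (\sum_(k <= j < N.+1) y j) <=
  p^-1 * \sum_(1 <= j < N.+1) Num.min (i%:R `^ p) (j%:R `^ p) * y j.
Proof.
move=> y0.
have -> : \sum_(1 <= k < i.+1) k%:R `^ (p - 1) * (\sum_(k <= j < N.+1) y j) =
    \sum_(1 <= k < i.+1) \sum_(1 <= j < N.+1)
      (if (k <= j)%N then k%:R `^ (p - 1) * y j else 0).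
  apply: eq_big_nat => k /andP[k1 _].
  by rewrite mulr_sumr (big_nat_widenl _ 1)// big_mkcond.
rewrite exchange_big mulr_sumr/=; apply: ler_sum_nat => j /andP[j1 _].
under eq_bigr do
  rewrite [X in if _ then X else _]mulrC -[X in if _ then _ else X](mulr0 (y j)) -fun_if.
rewrite -mulr_sumr [leRHS]mulrA [leRHS]mulrC ler_wpM2l ?y0//.
rewrite minr_pMr ?invr_ge0 ?(ltW p_gt0)// le_min; apply/andP; split.
  apply: le_trans (sum_powR_le i); apply: ler_sum => k _.
  by case: ifP => // _; exact: powR_ge0.
apply: le_trans (sum_powR_le j); rewrite -big_mkcond/=.
have [ij|ji] := leqP i j.
  rewrite (@big_nat_widen _ _ _ 1 i.+1 j.+1)// big_mkcond/= [leRHS]big_mkcond/=.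
  by apply: ler_sum => k _; case: ifP => // _; exact: powR_ge0.
by rewrite [leRHS](@big_nat_widen _ _ _ 1 j.+1 i.+1)//=; exact: ltnW.
Qed.
End powR_sums.

(** * Weighted sums of tail suprema *)

Section extended_reals.
Local Open Scope ereal_scope.
Variable R : realType.
Implicit Types (x y z : \bar R) (f g F G : nat -> \bar R).

Lemma le_poweR x y (r : R) : (0 <= r)%R -> 0 <= x -> x <= y -> x `^ r <= y `^ r.
Proof.
by move=> r0 x0 xy; apply: gt0_ler_poweR => //;
  rewrite in_itv/= leey andbT// (le_trans x0).
Qed.

Lemma poweRK x (r : R) : (0 < r)%R -> 0 <= x -> (x `^ r) `^ r^-1 = x.
Proof. by move=> r0 x0; rewrite -poweRrM divff ?gt_eqF// poweRe1. Qed.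

Lemma poweRVK x (r : R) : (0 < r)%R -> 0 <= x -> (x `^ r^-1) `^ r = x.
Proof. by move=> r0 x0; rewrite -poweRrM mulVf ?gt_eqF// poweRe1. Qed.

Lemma nneseries_le_ub f (m : nat) z : (forall n, (m <= n)%N -> 0 <= f n) ->
  (forall M, \sum_(m <= n < M) f n <= z) -> \sum_(m <= n <oo) f n <= z.
Proof.
move=> f0 le_z; apply: lime_le; last exact: nearW.
exact: is_cvg_ereal_nneg_natsum.
Qed.

Lemma lee_nneseries_from f g (m : nat) :
  (forall n, (m <= n)%N -> 0 <= f n <= g n) ->
  \sum_(m <= n <oo) f n <= \sum_(m <= n <oo) g n.
Proof.
move=> fg; have f0 n : (m <= n)%N -> 0 <= f n by move=> /fg /andP[].
have g0 n : (m <= n)%N -> 0 <= g n by move=> /fg /andP[]; exact: le_trans.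
apply: nneseries_le_ub => // M.
apply: (@le_trans _ _ (\sum_(m <= n < M) g n)).
  by rewrite !big_nat; apply: lee_sum => n /andP[/fg /andP[]].
by apply: nneseries_lim_ge => n mn _; exact: g0.
Qed.

Lemma nneseries_fin_support f (m N : nat) : (m <= N.+1)%N ->
  (forall n, (m <= n)%N -> 0 <= f n) -> (forall n, (N < n)%N -> f n = 0) ->
  \sum_(m <= n <oo) f n = \sum_(m <= n < N.+1) f n.
Proof.
move=> mN f0 fN; rewrite (@nneseries_split _ _ m (N.+1 - m)%N)//.
rewrite subnKC// [X in _ + X]eseries0 ?adde0// => n Nn _.
by rewrite fN.
Qed.

Lemma nneseries_tail_nonincreasing f (m i j : nat) : (m <= i)%N -> (i <= j)%N ->
  (forall n, (m <= n)%N -> 0 <= f n) ->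
  \sum_(j <= n <oo) f n <= \sum_(i <= n <oo) f n.
Proof.
move=> mi ij f0; rewrite (@nneseries_split _ _ i (j - i)%N); last first.
  by move=> k ik; apply: f0; exact: leq_trans ik.
rewrite subnKC// leeDr// big_nat sume_ge0// => k /andP[ik _].
by apply: f0; exact: leq_trans ik.
Qed.

Lemma nneseries_tail_ge_term f (m i : nat) : (m <= i)%N ->
  (forall n, (m <= n)%N -> 0 <= f n) -> f i <= \sum_(m <= n <oo) f n.
Proof.
move=> mi f0; apply: (@le_trans _ _ (\sum_(m <= n < i.+1) f n)); last first.
  by apply: nneseries_lim_ge => n mn _; exact: f0.
rewrite big_nat_recr//= leeDr// big_nat sume_ge0// => k /andP[ik _].
exact: f0.
Qed.

Lemma sup_from_le (m : nat) F z :
  (forall i, (m <= i)%N -> F i <= z) -> sup_from m F <= z.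
Proof. by move=> Fz; apply/ereal_supP => _ [i /= mi <-]; exact: Fz. Qed.

Lemma le_sup_from (m i : nat) F : (m <= i)%N -> F i <= sup_from m F.
Proof. by move=> mi; apply: ereal_sup_ubound; exists i. Qed.

Lemma sup_from_nonincreasing (i j : nat) F : (i <= j)%N ->
  sup_from j F <= sup_from i F.
Proof.
by move=> ij; apply: sup_from_le => k jk; apply: le_sup_from; exact: leq_trans jk.
Qed.

Lemma sup_upto_le (n : nat) F z :
  (forall k, (1 <= k <= n)%N -> F k <= z) -> sup_upto n F <= z.
Proof. by move=> Fz; apply/ereal_supP => _ [i /= mi <-]; exact: Fz. Qed.

Lemma le_sup_upto (n k : nat) F : (1 <= k <= n)%N -> F k <= sup_upto n F.
Proof. by move=> kn; apply: ereal_sup_ubound; exists k. Qed.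

(** The [q]-th power of every left-hand side: [r] is [q] in (i), (ii), (v) and [q / p] in (iii),
    (iv), (vi). *)
Definition weighted_sup_sum (a : nat -> R) (r : R) F : \bar R :=
  \sum_(1 <= m <oo) (sup_from m F) `^ r * (a m)%:E.

Section weighted_sup_sum_theory.
Variable a : nat -> R.
Hypothesis a_ge0 : nonneg_seq1 a.

Lemma weighted_sup_sum_ge0 (r : R) F : 0 <= weighted_sup_sum a r F.
Proof.
apply: nneseries_ge0 => m m1 _.
by rewrite mule_ge0 ?poweR_ge0// lee_fin a_ge0.
Qed.

(** Passes between the exponents [q] and [q / p]: a positive power is monotone, so it can be moved
    out of the supremum. *)
Lemma weighted_sup_sum_le_pow (r s : R) F G : (0 <= r)%R -> (0 < s)%R ->
  (forall i, (1 <= i)%N -> 0 <= F i) -> (forall i, (1 <= i)%N -> 0 <= G i) ->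
  (forall i, (1 <= i)%N -> F i <= G i `^ s) ->
  weighted_sup_sum a r F <= weighted_sup_sum a (r * s) G.
Proof.
move=> r0 s0 F0 G0 FG; apply: lee_nneseries_from => m m1.
rewrite mule_ge0 ?poweR_ge0 ?lee_fin ?a_ge0//=.
rewrite lee_wpmul2r ?lee_fin ?a_ge0// mulrC poweRrM.
apply: le_poweR => //; first exact: le_trans (F0 m m1) (le_sup_from F (leqnn m)).
apply: sup_from_le => i mi; have i1 : (1 <= i)%N by exact: leq_trans mi.
apply: (le_trans (FG i i1)); apply: le_poweR (ltW s0) (G0 i i1) _.
exact: le_sup_from.
Qed.

Lemma weighted_sup_sum_le (r : R) F G : (0 <= r)%R ->
  (forall i, (1 <= i)%N -> 0 <= F i) -> (forall i, (1 <= i)%N -> F i <= G i) ->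
  weighted_sup_sum a r F <= weighted_sup_sum a r G.
Proof.
move=> r0 F0 FG; rewrite -[r in leRHS]mulr1.
have G0 i : (1 <= i)%N -> 0 <= G i by move=> i1; exact: le_trans (F0 i i1) (FG i i1).
by apply: weighted_sup_sum_le_pow => // i i1; rewrite poweRe1 ?FG ?G0.
Qed.

(* The hypothesis on [F] says that [F] is at most the pointwise supremum of the [G N]. *)
Lemma weighted_sup_sum_monotone_limit (r : R) (G : nat -> nat -> \bar R) F z :
  (0 < r)%R ->
  (forall N i, (1 <= i)%N -> 0 <= G N i) ->
  (forall N M i, (1 <= i)%N -> (N <= M)%N -> G N i <= G M i) ->
  (forall i, (1 <= i)%N -> 0 <= F i) ->
  (forall i t, (1 <= i)%N -> (forall N, G N i <= t) -> F i <= t) ->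
  (forall N, weighted_sup_sum a r (G N) <= z) ->
  weighted_sup_sum a r F <= z.
Proof.
move=> r0 G0 Gnd F0 FG Gz.
pose T m N := (sup_from m (G N)) `^ r * (a m)%:E.
have supG0 m N : (1 <= m)%N -> 0 <= sup_from m (G N).
  by move=> m1; exact: le_trans (G0 N m m1) (le_sup_from _ (leqnn m)).
have T0 m N : (1 <= m)%N -> 0 <= T m N.
  by move=> m1; rewrite mule_ge0 ?poweR_ge0// lee_fin a_ge0.
have Tcvg m : (1 <= m)%N -> T m @ \oo --> ereal_sup (range (T m)).
  move=> m1; apply: ereal_nondecreasing_cvgn => N M NM.
  rewrite lee_wpmul2r ?lee_fin ?a_ge0//; apply: le_poweR (ltW r0) (supG0 m N m1) _.
  apply: sup_from_le => i mi; have i1 : (1 <= i)%N by exact: leq_trans mi.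
  exact: le_trans (Gnd _ _ _ i1 NM) (le_sup_from _ mi).
apply: nneseries_le_ub => [m m1|M].
  by rewrite mule_ge0 ?poweR_ge0// lee_fin a_ge0.
(* A finite sum of increasing limits is the limit of the sums, each of which is at most [z]. *)
apply: (@le_trans _ _ (\sum_(1 <= m < M) ereal_sup (range (T m)))); last first.
  rewrite big_nat_cond.
  have /cvge_to_le : \sum_(1 <= m < M | (1 <= m < M)%N && true) T m N @[N --> \oo] -->
      \sum_(1 <= m < M | (1 <= m < M)%N && true) ereal_sup (range (T m)).
    apply: cvg_nnesum => m /andP[/andP[m1 _] _]; last exact: Tcvg.
    by apply: nearW => N; exact: T0.
  apply.
  apply: nearW => N; rewrite -big_nat_cond; apply: le_trans (Gz N).
  by apply: nneseries_lim_ge => m m1 _; exact: T0.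
rewrite !big_nat; apply: lee_sum => m /andP[m1 _].
set L := ereal_sup _.
have TL N : T m N <= L by apply: ereal_sup_ubound; exists N.
have L0 : 0 <= L by exact: le_trans (T0 m 0%N m1) (TL 0%N).
have [->|am] := eqVneq (a m) 0%R; first by rewrite mule0.
have am0 : (0 < a m)%R by rewrite lt_def am a_ge0.
rewrite -lee_pdivlMr//.
have La0 : 0 <= L * ((a m)^-1)%:E by rewrite mule_ge0// lee_fin invr_ge0 ltW.
(* Removing the power [r] leaves a bound of [F i] by a number independent of [i] and [N], the form
   in which [F] is controlled. *)
rewrite -[leRHS](poweRVK r0 La0).
apply: le_poweR (ltW r0) (le_trans (F0 m m1) (le_sup_from _ (leqnn m))) _.
apply: sup_from_le => i mi; have i1 : (1 <= i)%N by exact: leq_trans mi.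
apply: FG => // N; apply: le_trans (le_sup_from (G N) mi) _.
rewrite -[leLHS](poweRK r0) ?supG0//; apply: le_poweR.
- by rewrite invr_ge0 ltW.
- exact: poweR_ge0.
- by rewrite lee_pdivlMr//; exact: TL.
Qed.

End weighted_sup_sum_theory.
End extended_reals.

(** * Comparison of best constants *)

Section constants.
Local Open Scope ereal_scope.
Variable R : realType.
Implicit Types I J : R -> Prop.

Definition upward_closed I := forall D D', (D <= D')%R -> I D -> I D'.

(** Only [D > 0] is considered: since [0 * +oo = 0], an inequality with constant 0 is not automatic
    when its right-hand series diverges. *)
Definition transfers (k : R) I J := forall D, (0 < D)%R -> I D -> J (k * D)%R.

Definition comparable k I J :=
  [/\ upward_closed J, transfers k I J & transfers k J I].

Lemma transfers_weaken (k k' : R) I J : upward_closed J -> (k <= k')%R ->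
  transfers k I J -> transfers k' I J.
Proof.
move=> upJ kk' IJ D D0 /(IJ D D0); apply: upJ.
by rewrite ler_wpM2r// ltW.
Qed.

Lemma transfers_holds (k : R) I J : (0 <= k)%R -> upward_closed I ->
  transfers k I J ->
  holds_with_finite_constant I -> holds_with_finite_constant J.
Proof.
move=> k0 upI IJ [D [D0 ID]]; exists (k * (D + 1))%R.
have D10 : (0 < D + 1)%R by rewrite ltr_wpDl.
split; first by rewrite mulr_ge0// ltW.
by apply: IJ => //; apply: upI ID; rewrite lerDl.
Qed.

(* [D + e] with [e > 0] replaces [D] because [transfers] says nothing about [D = 0]. *)
Lemma transfers_best_constant (k : R) I J : (0 < k)%R -> upward_closed I ->
  transfers k I J -> (k^-1)%:E * best_constant J <= best_constant I.
Proof.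
move=> k0 upI IJ; apply/ereal_infP => _ [D [D0 ID] <-].
apply/lee_addgt0Pr => e e0; rewrite lee_pdivrMl//.
have De0 : (0 < D + e)%R by rewrite ltr_wpDl.
apply: ereal_inf_lbound; exists (k * (D + e))%R => //; split.
  by rewrite mulr_ge0// ltW.
by apply: IJ => //; apply: upI ID; rewrite lerDl ltW.
Qed.

Lemma transfers_equiv_up_to (k : R) I J : (0 < k)%R ->
  upward_closed I -> upward_closed J -> transfers k I J -> transfers k J I ->
  equiv_up_to k (best_constant I) (best_constant J).
Proof.
move=> k0 upI upJ IJ JI; split; first exact: transfers_best_constant.
by rewrite -lee_pdivrMl//; exact: transfers_best_constant.
Qed.
End constants.

(** * The six inequalities *)

Section equivalences.
Local Open Scope ereal_scope.
Variables (R : realType) (p q : R) (a b u : nat -> R).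
Hypotheses (q_gt0 : (0 < q)%R) (p_gt0 : (0 < p)%R) (p_le1 : (p <= 1)%R).
Hypotheses (a_ge0 : nonneg_seq1 a) (b_ge0 : nonneg_seq1 b) (u_ge0 : nonneg_seq1 u).
Hypothesis b1_gt0 : (0 < b 1%N)%R.

Implicit Types x y : nat -> R.

Local Notation B := (partial_sum1 b).
Local Notation tail y k := (\sum_(k <= j <oo) (y j)%:E).
Local Notation weight y := (\sum_(1 <= m <oo) (y m * B m)%:E).

Let q0 : (0 <= q)%R. Proof. exact: ltW. Qed.
Let p0 : (0 <= p)%R. Proof. exact: ltW. Qed.
Let pV_gt0 : (0 < p^-1)%R. Proof. by rewrite invr_gt0. Qed.
Let pV0 : (0 <= p^-1)%R. Proof. exact: ltW. Qed.
Let qV0 : (0 <= q^-1)%R. Proof. by rewrite invr_ge0. Qed.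
Let qp_gt0 : (0 < q / p)%R. Proof. by rewrite divr_gt0. Qed.

Lemma partial_sum1_ge0 m : (0 <= B m)%R.
Proof. by rewrite /partial_sum1 big_nat sumr_ge0// => k /andP[k1 _]; exact: b_ge0. Qed.

Lemma partial_sum1_ge_first m : (1 <= m)%N -> (b 1%N <= B m)%R.
Proof.
move=> m1; rewrite /partial_sum1 big_ltn// lerDl big_nat sumr_ge0// => k /andP[k1 _].
by apply: b_ge0; exact: leq_trans k1.
Qed.

Lemma tail_ge0 y k : nonneg_seq1 y -> (1 <= k)%N -> 0 <= tail y k.
Proof.
by move=> y0 k1; apply: nneseries_ge0 => n kn _; rewrite lee_fin y0// (leq_trans k1).
Qed.

Lemma weight_ge0 y : nonneg_seq1 y -> 0 <= weight y.
Proof.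
by move=> y0; apply: nneseries_ge0 => n n1 _; rewrite lee_fin mulr_ge0 ?y0 ?partial_sum1_ge0.
Qed.

Lemma tail_nonincreasing y i j : nonneg_seq1 y -> (1 <= i)%N -> (i <= j)%N ->
  tail y j <= tail y i.
Proof.
move=> y0 i1 ij.
by apply: (@nneseries_tail_nonincreasing _ _ 1) => // n n1; rewrite lee_fin y0.
Qed.

Lemma sup_from_le_tail y k : nonneg_seq1 y -> (1 <= k)%N ->
  sup_from k (fun j => (y j)%:E) <= tail y k.
Proof.
move=> y0 k1; apply: sup_from_le => j kj.
apply: (nneseries_tail_ge_term (f := fun j => (y j)%:E)) => // n kn.
by rewrite lee_fin y0// (leq_trans k1).
Qed.

Lemma sup_from_ge0 y k : nonneg_seq1 y -> (1 <= k)%N ->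
  0 <= sup_from k (fun j => (y j)%:E).
Proof.
move=> y0 k1; apply: (@le_trans _ _ (y k)%:E); first by rewrite lee_fin y0.
exact: (le_sup_from (fun j => (y j)%:E)).
Qed.

(** Since [B m >= b 1 > 0], a finite weight forces [y] to be summable, and the tails can be handled
    as real numbers. *)
Lemma tail_fin y : nonneg_seq1 y -> weight y < +oo ->
  exists Y : nat -> R, [/\ forall k, (1 <= k)%N -> tail y k = (Y k)%:E,
    forall k, (1 <= k)%N -> (0 <= Y k)%R &
    forall i j, (1 <= i)%N -> (i <= j)%N -> (Y j <= Y i)%R].
Proof.
move=> y0 Sfin.
have tfin k : (1 <= k)%N -> tail y k = (fine (tail y k))%:E.
  move=> k1; rewrite fineK// ge0_fin_numE ?tail_ge0//.
  apply: le_lt_trans (tail_nonincreasing y0 (leqnn 1) k1) _.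
  apply: (@le_lt_trans _ _ ((b 1%N)^-1%:E * weight y)); last first.
    by rewrite lte_mul_pinfty// lee_fin invr_ge0 ltW.
  apply: nneseries_le_ub => [n n1|M]; first by rewrite lee_fin y0.
  apply: (@le_trans _ _ ((b 1%N)^-1%:E * \sum_(1 <= m < M) (y m * B m)%:E)).
    rewrite !sumEFin -EFinM lee_fin mulr_sumr; apply: ler_sum_nat => m /andP[m1 _].
    rewrite mulrCA ler_peMr ?y0// mulrC ler_pdivlMr// mul1r.
    exact: partial_sum1_ge_first.
  rewrite lee_wpmul2l ?lee_fin ?invr_ge0 ?(ltW b1_gt0)//.
  by apply: nneseries_lim_ge => m m1 _; rewrite lee_fin mulr_ge0 ?y0 ?partial_sum1_ge0.
exists (fun k => fine (tail y k)); split => //.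
  by move=> k k1; rewrite fine_ge0// tail_ge0.
move=> i j i1 ij; rewrite -lee_fin -!tfin ?tail_nonincreasing//.
exact: leq_trans ij.
Qed.

Lemma le_rhs_of_finite (D : R) y (z : \bar R) : (0 < D)%R -> nonneg_seq1 y ->
  (weight y < +oo -> z <= D%:E * (weight y) `^ p^-1) ->
  z <= D%:E * (weight y) `^ p^-1.
Proof.
move=> D0 y0 le_fin; have [->|wy] := eqVneq (weight y) +oo; last first.
  by apply: le_fin; rewrite ltey.
by rewrite poweRyr ?gt_eqF// gt0_muley ?lte_fin// leey.
Qed.

(** Apply (i) to the tails of [y] raised to [1/p]. The left-hand sides agree, and exchanging sums
    turns the tails weighted by [b] into [y] weighted by [B]. *)
Lemma monotone_to_sum_tail (D : R) : (0 < D)%R ->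
  ineq_monotone p q a b u D -> ineq_sum_tail p q a b u D.
Proof.
move=> D0 I y y0; apply: le_rhs_of_finite => // Sfin.
have [Y [tY Y0 Yni]] := tail_fin y0 Sfin.
pose x k := (Y k `^ p^-1)%R.
have x0 : nonneg_seq1 x by move=> m _; exact: powR_ge0.
have xni : nonincreasing_seq1 x.
  move=> m n m1 mn; have n1 : (1 <= n)%N by exact: leq_trans mn.
  by rewrite ge0_ler_powR ?nnegrE ?Y0 ?Yni.
have := I x x0 xni.
set Lx := (X in X `^ q^-1 <= _); set Ly := (X in _ -> X `^ q^-1 <= _).
have -> : Ly = Lx.
  rewrite /Ly /Lx; apply: congr_lim; apply/funext => M; apply: eq_big_nat => m /andP[m1 _].
  congr (_ `^ _ * _); congr ereal_sup; apply: eq_imagel => i /= mi.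
  congr (_ * _); apply: eq_big_nat => k /andP[k1 _].
  by rewrite tY// poweR_EFin.
move=> /le_trans; apply; rewrite lee_wpmul2l ?lee_fin ?(ltW D0)//.
have xb0 m : (1 <= m)%N -> 0 <= (x m `^ p * b m)%:E.
  by move=> m1; rewrite lee_fin mulr_ge0 ?powR_ge0 ?b_ge0.
apply: le_poweR => //; first by apply: nneseries_ge0 => m m1 _; exact: xb0.
have xpE k : (1 <= k)%N -> (x k `^ p)%R = Y k.
  by move=> k1; rewrite /x -powRrM mulVf ?gt_eqF// powRr1 ?Y0.
apply: nneseries_le_ub => // M.
(* Extension by zero outside [k <= j] lets every inner series start at 1, so that the sums can be
   exchanged. *)
pose c k j : \bar R := (if (1 <= k <= j)%N then b k * y j else 0)%:E.
have c0 k j : 0 <= c k j.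
  rewrite lee_fin; case: ifPn => // /andP[k1 kj].
  by rewrite mulr_ge0 ?b_ge0 ?y0// (leq_trans k1).
apply: (@le_trans _ _ (\sum_(1 <= k < M) \sum_(1 <= j <oo) c k j)).
  rewrite !big_nat; apply: lee_sum => k /andP[k1 kM].
  rewrite xpE// [(Y k * b k)%R]mulrC EFinM -tY//.
  apply: (@le_trans _ _ (\sum_(k <= j <oo) c k j)); last first.
    exact: (@nneseries_tail_nonincreasing _ (c k) 1 1 k).
  have [b0|bk] := eqVneq (b k) 0%R.
    by rewrite b0 mul0e nneseries_ge0.
  have bk0 : (0 < b k)%R by rewrite lt_def bk b_ge0.
  rewrite -lee_pdivlMl//; apply: nneseries_le_ub => [j kj|M'].
    by rewrite lee_fin y0// (leq_trans k1).
  rewrite lee_pdivlMl//; apply: (@le_trans _ _ (\sum_(k <= j < M') c k j)).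
    rewrite !sumEFin -EFinM lee_fin mulr_sumr; apply: ler_sum_nat => j /andP[kj _].
    by rewrite k1 kj.
  by apply: nneseries_lim_ge => j _ _.
rewrite -nneseries_sum_nat//; apply: lee_nneseries_from => j j1.
rewrite sume_ge0//= sumEFin lee_fin mulrC -big_mkcond/= -mulr_suml ler_wpM2r ?y0//.
rewrite /partial_sum1 (@big_nat_widen _ _ _ 1 M (maxn M j.+1)) ?leq_maxl//.
rewrite [leRHS](@big_nat_widen _ _ _ 1 j.+1 (maxn M j.+1)) ?leq_maxr//.
rewrite big_mkcond [leRHS]big_mkcond/=; apply: ler_sum_nat => k /andP[k1 _].
rewrite k1 ltnS/=; case: (leqP k j) => _ //=.
by case: ifP => // _; exact: b_ge0.
Qed.

Lemma sum_by_parts (g : nat -> R) n :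
  (\sum_(1 <= j < n.+1) (g j - g j.+1) * B j =
   \sum_(1 <= j < n.+1) g j * b j - g n.+1 * B n)%R.
Proof.
elim: n => [|n IH]; first by rewrite /partial_sum1 !big_geq// mulr0 subrr.
rewrite [LHS]big_nat_recr//= IH [in RHS]big_nat_recr//=.
have -> : (B n.+1 = B n + b n.+1)%R by rewrite /partial_sum1 big_nat_recr.
ring.
Qed.

(** The differences of [x^p] have tails [x^p] only if [x] tends to 0. Hence [x] is cut off after
    [N], summation by parts compares the weights, and [N] tends to infinity. *)
Lemma sum_tail_to_monotone (D : R) : (0 < D)%R ->
  ineq_sum_tail p q a b u D -> ineq_monotone p q a b u D.
Proof.
move=> D0 I x x0 xni; set S := (X in _ <= _ * X `^ _).
pose xN N k := if (k <= N)%N then x k else 0%R.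
pose G N i := (u i)%:E * \sum_(1 <= k < i.+1) (xN N k)%:E.
have xN0 N k : (1 <= k)%N -> (0 <= xN N k)%R.
  by move=> k1; rewrite /xN; case: ifP => // _; exact: x0.
have rhs0 : 0 <= D%:E * S `^ p^-1 by rewrite mule_ge0 ?poweR_ge0// lee_fin ltW.
have G0 N i : (1 <= i)%N -> 0 <= G N i.
  move=> i1; rewrite mule_ge0 ?lee_fin ?u_ge0// big_nat sume_ge0// => k /andP[k1 _].
  by rewrite lee_fin xN0.
suff le_F : weighted_sup_sum a q (fun i => (u i)%:E * \sum_(1 <= k < i.+1) (x k)%:E)
    <= (D%:E * S `^ p^-1) `^ q.
  rewrite -[leRHS](poweRK q_gt0)//; apply: le_poweR => //.
  exact: weighted_sup_sum_ge0.
apply: (weighted_sup_sum_monotone_limit a_ge0 (G := G)) => //.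
- move=> N M i i1 NM; rewrite lee_wpmul2l ?lee_fin ?u_ge0//.
  rewrite !big_nat; apply: lee_sum => k /andP[k1 _]; rewrite lee_fin /xN.
  case: (leqP k N) => [kN|_]; first by rewrite (leq_trans kN NM).
  by case: ifP => // _; exact: x0.
- move=> i i1; rewrite mule_ge0 ?lee_fin ?u_ge0// big_nat sume_ge0// => k /andP[k1 _].
  by rewrite lee_fin x0.
(* The cut-off at [N = i] does not affect the sum up to [i]. *)
- move=> i t i1 Gt; apply: le_trans (Gt i); rewrite lee_wpmul2l ?lee_fin ?u_ge0//.
  rewrite !big_nat; apply: lee_sum => k /andP[_ ki].
  by rewrite /xN -ltnS ki.
move=> N; pose g j := if (j <= N)%N then (x j `^ p)%R else 0%R.
pose y j := (g j - g j.+1)%R.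
have y0 : nonneg_seq1 y.
  move=> j j1; rewrite /y /g; case: (ltnP j N) => [jN|Nj].
    rewrite (ltnW jN) subr_ge0 ge0_ler_powR ?nnegrE ?x0//.
    exact: xni.
  by rewrite subr0; case: ifP => // _; exact: powR_ge0.
have yN j : (N < j)%N -> y j = 0%R.
  by move=> Nj; rewrite /y /g !ifN ?subrr// -ltnNge ?(leqW Nj).
have tyE k : (1 <= k)%N -> tail y k = (g k)%:E.
  move=> k1; rewrite (@nneseries_fin_support _ _ k (maxn k N)).
  - rewrite sumEFin; congr EFin.
    under eq_bigr do rewrite /y -opprB.
    rewrite sumrN telescope_sumr; last by rewrite leqW// leq_maxl.
    by rewrite opprB /g [X in (_ - X)%R]ifN ?subr0// -ltnNge ltnS leq_maxr.
  - by rewrite leqW// leq_maxl.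
  - by move=> n kn; rewrite lee_fin y0// (leq_trans k1).
  - by move=> n; rewrite gtn_max => /andP[_ Nn]; rewrite yN.
have gE k : (1 <= k)%N -> (g k)%:E `^ p^-1 = (xN N k)%:E.
  move=> k1; rewrite poweR_EFin /g /xN; case: ifP => _.
    by rewrite -powRrM divff ?gt_eqF// powRr1 ?x0.
  by rewrite powR0// gt_eqF.
have weight_le : weight y <= S.
  rewrite (@nneseries_fin_support _ _ 1 N)//; first last.
  - by move=> n Nn; rewrite yN// mul0r.
  - by move=> n n1; rewrite lee_fin mulr_ge0 ?y0 ?partial_sum1_ge0.
  rewrite sumEFin sum_by_parts.
  apply: (@le_trans _ _ (\sum_(1 <= m < N.+1) (x m `^ p * b m)%:E)).
    (* The boundary term vanishes because [g N.+1 = 0]. *)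
    rewrite sumEFin lee_fin {2}/g ltnn mul0r subr0; apply: ler_sum_nat => j /andP[_ jN].
    by rewrite /g -ltnS jN.
  by apply: nneseries_lim_ge => m m1 _; rewrite lee_fin mulr_ge0 ?powR_ge0 ?b_ge0.
rewrite -[leLHS](poweRVK q_gt0) ?weighted_sup_sum_ge0//.
apply: le_poweR => //; first exact: poweR_ge0.
apply: (@le_trans _ _ (D%:E * (weight y) `^ p^-1)); last first.
  by rewrite lee_wpmul2l ?lee_fin ?(ltW D0)//; apply: le_poweR => //; exact: weight_ge0.
apply: le_trans (I y y0); apply: le_poweR => //; first exact: weighted_sup_sum_ge0.
apply: weighted_sup_sum_le => // [|i i1]; first exact: G0.
rewrite lee_wpmul2l ?lee_fin ?u_ge0// !big_nat; apply: lee_sum => k /andP[k1 _].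
by rewrite tyE// gE.
Qed.

(** This is [powR_sum_le] for the tails raised to [1/p], which are non-increasing. *)
Lemma weighted_sum_tail_to_sum_tail (D : R) : (0 < D)%R ->
  ineq_weighted_sum_tail p q a b u D -> ineq_sum_tail p q a b u D.
Proof.
move=> D0 I y y0; apply: le_rhs_of_finite => // Sfin.
have [Y [tY Y0 Yni]] := tail_fin y0 Sfin.
apply: le_trans (I y y0); apply: le_poweR => //; first exact: weighted_sup_sum_ge0.
apply: weighted_sup_sum_le_pow => //.
- move=> i i1; rewrite mule_ge0 ?lee_fin ?u_ge0//.
  by apply: sume_ge0 => k _; exact: poweR_ge0.
- move=> i i1; rewrite mule_ge0 ?lee_fin ?powR_ge0// big_nat sume_ge0// => k /andP[k1 _].
  by rewrite mule_ge0 ?tail_ge0// lee_fin powR_ge0.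
move=> i i1.
have -> : \sum_(1 <= k < i.+1) (tail y k) `^ p^-1 =
    (\sum_(1 <= k < i.+1) Y k `^ p^-1)%R%:E.
  by rewrite -sumEFin; apply: eq_big_nat => k /andP[k1 _]; rewrite tY// poweR_EFin.
have -> : \sum_(1 <= k < i.+1) ((k%:R `^ (p - 1))%:E * tail y k) =
    (\sum_(1 <= k < i.+1) k%:R `^ (p - 1) * Y k)%R%:E.
  by rewrite -sumEFin; apply: eq_big_nat => k /andP[k1 _]; rewrite tY// EFinM.
rewrite -!EFinM poweR_EFin lee_fin.
set f := fun k => (Y k `^ p^-1)%R.
have f0 j : (1 <= j)%N -> (0 <= f j)%R by move=> _; exact: powR_ge0.
have fni m n : (1 <= m)%N -> (m <= n)%N -> (f n <= f m)%R.
  move=> m1 mn; have n1 : (1 <= n)%N by exact: leq_trans mn.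
  by rewrite ge0_ler_powR ?nnegrE ?Y0 ?Yni.
have sf0 : (0 <= \sum_(1 <= k < i.+1) f k)%R.
  by rewrite sumr_ge0// => k _; exact: powR_ge0.
have -> : (u i * \sum_(1 <= k < i.+1) f k =
    ((u i * \sum_(1 <= k < i.+1) f k) `^ p) `^ p^-1)%R.
  by rewrite -powRrM divff ?gt_eqF// powRr1// mulr_ge0// u_ge0.
rewrite ge0_ler_powR ?nnegrE ?powR_ge0//.
  rewrite mulr_ge0 ?powR_ge0// big_nat sumr_ge0// => k /andP[k1 _].
  by rewrite mulr_ge0 ?powR_ge0 ?Y0.
rewrite powRM ?u_ge0// ler_wpM2l ?powR_ge0//.
apply: (le_trans (powR_sum_le p_gt0 p_le1 i f0 fni)).
apply: ler_sum_nat => k /andP[k1 _].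
by rewrite /f -powRrM mulVf ?gt_eqF// powRr1 ?Y0.
Qed.

(** As [T] is non-increasing, [k] copies of [T k] to the power [1/p] are at most the sum of the
    first [k] terms. *)
Lemma sup_upto_le_sum_pow (T : nat -> \bar R) i :
  (forall k, (1 <= k)%N -> 0 <= T k) ->
  (forall j k, (1 <= j)%N -> (j <= k)%N -> T k <= T j) ->
  sup_upto i (fun k => (k%:R `^ p)%:E * T k) <=
  (\sum_(1 <= k < i.+1) (T k) `^ p^-1) `^ p.
Proof.
move=> T0 Tni; apply: sup_upto_le => k /andP[k1 ki].
rewrite -[T k](poweRVK p_gt0) ?T0// -poweR_EFin -poweRM ?poweR_ge0 ?lee_fin//.
apply: le_poweR => //; first by rewrite mule_ge0 ?poweR_ge0 ?lee_fin.
apply: (@le_trans _ _ (\sum_(1 <= j < k.+1) (T j) `^ p^-1)); last first.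
  by apply: lee_sum_nneg_natr => // n _ _; exact: poweR_ge0.
have -> : k%:R%:E * (T k) `^ p^-1 = \sum_(1 <= j < k.+1) (T k) `^ p^-1.
  rewrite big_const_nat subSS subn0.
  move: (_ `^ _) (poweR_ge0 (T k) p^-1) => t t0; elim: (k) => [|n IH]; first by rewrite mul0e.
  by rewrite iterS -IH -natr1 EFinD ge0_muleDl ?lee_fin// mul1e addeC.
rewrite !big_nat; apply: lee_sum => j /andP[j1 jk].
by apply: le_poweR => //; [exact: T0|exact: Tni].
Qed.

(** With [T] the tail sums this yields (ii) => (iv), with [T] the tail suprema (v) => (vi). *)
Lemma weighted_sup_upto_le (T : nat -> \bar R) :
  (forall k, (1 <= k)%N -> 0 <= T k) ->
  (forall j k, (1 <= j)%N -> (j <= k)%N -> T k <= T j) ->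
  weighted_sup_sum a (q / p) (fun i => (u i `^ p)%:E *
    sup_upto i (fun k => (k%:R `^ p)%:E * T k)) <=
  weighted_sup_sum a q (fun i => (u i)%:E * \sum_(1 <= k < i.+1) (T k) `^ p^-1).
Proof.
move=> T0 Tni; rewrite -[q in leRHS](divfK (lt0r_neq0 p_gt0)).
have s0 i : 0 <= \sum_(1 <= k < i.+1) (T k) `^ p^-1.
  by apply: sume_ge0 => k _; exact: poweR_ge0.
apply: weighted_sup_sum_le_pow => // [|i i1|i i1|i i1]; first exact: ltW.
- rewrite mule_ge0 ?lee_fin ?powR_ge0//.
  apply: (@le_trans _ _ ((1%N%:R `^ p)%:E * T 1%N)).
    by rewrite mule_ge0 ?T0// lee_fin powR_ge0.
  by apply: (le_sup_upto (fun k => (k%:R `^ p)%:E * T k)); rewrite i1.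
- by rewrite mule_ge0 ?lee_fin ?u_ge0.
- rewrite poweRM ?lee_fin ?u_ge0// poweR_EFin lee_wpmul2l ?lee_fin ?powR_ge0//.
  exact: sup_upto_le_sum_pow.
Qed.

Lemma sum_tail_to_sup_tail (D : R) :
  ineq_sum_tail p q a b u D -> ineq_sup_tail p q a b u D.
Proof.
move=> I y y0; apply: le_trans (I y y0).
apply: le_poweR => //; first exact: weighted_sup_sum_ge0.
apply: (weighted_sup_upto_le (T := fun k => tail y k)) => [k k1|j k j1 jk].
  exact: tail_ge0.
exact: tail_nonincreasing.
Qed.

Lemma sum_sup_to_sup_sup (D : R) :
  ineq_sum_sup p q a b u D -> ineq_sup_sup p q a b u D.
Proof.
move=> I y y0; apply: le_trans (I y y0).
apply: le_poweR => //; first exact: weighted_sup_sum_ge0.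
apply: (weighted_sup_upto_le (T := fun k => sup_from k (fun j => (y j)%:E)))
  => [k k1|j k j1 jk].
  exact: sup_from_ge0.
exact: sup_from_nonincreasing.
Qed.

Lemma sum_tail_to_sum_sup (D : R) :
  ineq_sum_tail p q a b u D -> ineq_sum_sup p q a b u D.
Proof.
move=> I y y0; apply: le_trans (I y y0).
apply: le_poweR => //; first exact: weighted_sup_sum_ge0.
apply: weighted_sup_sum_le => // i i1.
  rewrite mule_ge0 ?lee_fin ?u_ge0//.
  by apply: sume_ge0 => k _; exact: poweR_ge0.
rewrite lee_wpmul2l ?lee_fin ?u_ge0// !big_nat; apply: lee_sum => k /andP[k1 _].
by apply: le_poweR => //; [exact: sup_from_ge0|exact: sup_from_le_tail].
Qed.

Lemma sup_tail_to_sup_sup (D : R) :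
  ineq_sup_tail p q a b u D -> ineq_sup_sup p q a b u D.
Proof.
move=> I y y0; apply: le_trans (I y y0).
apply: le_poweR => //; first exact: weighted_sup_sum_ge0.
apply: weighted_sup_sum_le => // [|i i1|i i1]; first exact: ltW.
  rewrite mule_ge0 ?lee_fin ?powR_ge0//.
  apply: (@le_trans _ _ ((1%N%:R `^ p)%:E * sup_from 1 (fun j => (y j)%:E))).
    by rewrite mule_ge0 ?sup_from_ge0// lee_fin powR_ge0.
  by apply: (le_sup_upto (fun k => (k%:R `^ p)%:E * sup_from k (fun j => (y j)%:E)));
    rewrite i1.
rewrite lee_wpmul2l ?lee_fin ?powR_ge0//; apply: sup_upto_le => k /andP[k1 ki].
apply: (@le_trans _ _ ((k%:R `^ p)%:E * tail y k)).
  by rewrite lee_wpmul2l ?lee_fin ?powR_ge0// sup_from_le_tail.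
by apply: (le_sup_upto (fun k => (k%:R `^ p)%:E * tail y k)); rewrite k1.
Qed.

(** In [32 / p], the 8 comes from covering, the 4 from the cost of the sparse sequence, and [1/p]
    from summing [k^(p-1)]. The power [1/p] is that of the right-hand side. *)
Lemma sup_sup_to_weighted_sum_tail (D : R) : (0 < D)%R ->
  ineq_sup_sup p q a b u D ->
  ineq_weighted_sum_tail p q a b u ((32 / p) `^ p^-1 * D).
Proof.
move=> D0 I y y0; set S := (X in _ <= _ * X `^ _).
have S0 : 0 <= S by exact: weight_ge0.
have rhsE : ((32 / p) `^ p^-1 * D)%:E * S `^ p^-1 = D%:E * ((32 / p)%:E * S) `^ p^-1.
  by rewrite poweRM ?lee_fin ?divr_ge0 ?ler0n// poweR_EFin mulrC EFinM muleA.
rewrite {}rhsE; set rhs := _ * _ `^ _.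
have rhs0 : 0 <= rhs by rewrite mule_ge0 ?poweR_ge0// lee_fin ltW.
pose G N i := (u i `^ p)%:E * \sum_(1 <= k < i.+1)
   ((k%:R `^ (p - 1))%:E * \sum_(k <= j < N.+1) (y j)%:E).
have tailN0 k N : (1 <= k)%N -> 0 <= \sum_(k <= j < N.+1) (y j)%:E.
  move=> k1; rewrite big_nat sume_ge0// => j /andP[kj _].
  by rewrite lee_fin y0// (leq_trans k1).
have G0 N i : (1 <= i)%N -> 0 <= G N i.
  move=> i1; rewrite mule_ge0 ?lee_fin ?powR_ge0// big_nat sume_ge0// => k /andP[k1 _].
  by rewrite mule_ge0 ?tailN0// lee_fin powR_ge0.
suff le_F : weighted_sup_sum a (q / p) (fun i => (u i `^ p)%:E * \sum_(1 <= k < i.+1)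
   ((k%:R `^ (p - 1))%:E * tail y k)) <= rhs `^ q.
  rewrite -[leRHS](poweRK q_gt0)//; apply: le_poweR => //.
  exact: weighted_sup_sum_ge0.
apply: (weighted_sup_sum_monotone_limit a_ge0 (G := G)) => //.
- move=> N M i i1 NM; rewrite lee_wpmul2l ?lee_fin ?powR_ge0//.
  rewrite !big_nat; apply: lee_sum => k /andP[k1 _].
  rewrite lee_wpmul2l ?lee_fin ?powR_ge0//; apply: lee_sum_nneg_natr => // j kj _.
  by rewrite lee_fin y0// (leq_trans k1).
- move=> i i1; rewrite mule_ge0 ?lee_fin ?powR_ge0// big_nat sume_ge0// => k /andP[k1 _].
  by rewrite mule_ge0 ?tail_ge0// lee_fin powR_ge0.
(* The cut-off expressions converge to the full one, so a common bound survives. *)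
- move=> i t i1 Gt.
  have : G N i @[N --> \oo] --> (u i `^ p)%:E * \sum_(1 <= k < i.+1)
     ((k%:R `^ (p - 1))%:E * tail y k).
    apply: cvgeZl => //; rewrite /G.
    rewrite [X in _ --> X]big_nat_cond.
    under eq_fun do rewrite big_nat_cond.
    apply: cvg_nnesum => k /andP[/andP[k1 _] _].
      by apply: nearW => N; rewrite mule_ge0 ?tailN0// lee_fin powR_ge0.
    apply: cvgeZl => //.
    rewrite (cvg_shiftS (fun M => \sum_(k <= j < M) (y j)%:E)).
    apply: is_cvg_ereal_nneg_natsum => j kj.
    by rewrite lee_fin y0// (leq_trans k1).
  by move=> /cvge_to_le; apply; exact: nearW.
move=> N.
have [z [[z0 zN] zmaj zcost]] := @sparse_majorant R (fun j => j%:R `^ p)%R y B N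
  (natr_powR_gt0 p) (fun i j _ => natr_powR_nd p_gt0 (i:=i) (j:=j))
  (natr_powR_doubling p_gt0 p_le1) y0 (fun m _ => partial_sum1_ge0 m).
(* The loss on the left is put into the test sequence, to which (vi) is applied. *)
pose y' j := (8 / p * z j)%R.
have y'0 : nonneg_seq1 y' by move=> j _; rewrite mulr_ge0 ?divr_ge0.
have weight_le : weight y' <= (32 / p)%:E * S.
  rewrite (@nneseries_fin_support _ _ 1 N)//; first last.
  - by move=> n Nn; rewrite /y' zN ?mulr0 ?mul0r// negb_and -!ltnNge Nn orbT.
  - by move=> n n1; rewrite lee_fin mulr_ge0 ?y'0 ?partial_sum1_ge0.
  apply: (@le_trans _ _ ((32 / p)%:E * \sum_(1 <= m < N.+1) (y m * B m)%:E)).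
    rewrite !sumEFin -EFinM lee_fin.
    under eq_bigr do rewrite -mulrA.
    rewrite -mulr_sumr (_ : 32 / p = 8 / p * 4)%R; last by field; rewrite gt_eqF.
    by rewrite -[leRHS]mulrA ler_wpM2l// divr_ge0.
  rewrite lee_wpmul2l ?lee_fin ?divr_ge0//.
  by apply: nneseries_lim_ge => m m1 _; rewrite lee_fin mulr_ge0 ?y0 ?partial_sum1_ge0.
rewrite -[leLHS](poweRVK q_gt0) ?weighted_sup_sum_ge0//.
apply: le_poweR => //; first exact: poweR_ge0.
apply: (@le_trans _ _ (D%:E * (weight y') `^ p^-1)); last first.
  by rewrite lee_wpmul2l ?lee_fin ?(ltW D0)//; apply: le_poweR => //; exact: weight_ge0.
apply: le_trans (I y' y'0); apply: le_poweR => //; first exact: weighted_sup_sum_ge0.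
apply: weighted_sup_sum_le => // [|i i1|i i1]; [exact: ltW|exact: G0|].
rewrite lee_wpmul2l ?lee_fin ?powR_ge0//.
have [j j1 le8] := zmaj i i1.
(* The single mass at [j] enters the double supremum through [k = min(i, j)], which is at most both
   [i] and [j]. *)
apply: (@le_trans _ _ ((minn i j)%:R `^ p * y' j)%:E).
  under eq_bigr do rewrite sumEFin -EFinM.
  rewrite sumEFin lee_fin; apply: (le_trans (weighted_tail_sum_le p_gt0 p_le1 N i y0)).
  rewrite -[leRHS](mulKf (lt0r_neq0 p_gt0)) ler_wpM2l ?invr_ge0//.
  apply: (le_trans le8); rewrite le_eqVlt; apply/orP; left; apply/eqP.
  have -> : Num.min (i%:R `^ p)%R (j%:R `^ p)%R = ((minn i j)%:R `^ p)%R.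
    case: (leqP i j) => [ij|/ltnW ji].
      by rewrite min_l ?natr_powR_nd.
    by rewrite min_r ?natr_powR_nd.
  by rewrite /y'; field; rewrite gt_eqF.
have minij : (1 <= minn i j <= i)%N by rewrite leq_min i1 j1 geq_minl.
apply: le_trans (le_sup_upto
  (fun k => (k%:R `^ p)%:E * sup_from k (fun j => (y' j)%:E)) minij).
rewrite EFinM lee_wpmul2l ?lee_fin ?powR_ge0//.
by apply: (le_sup_from (fun j => (y' j)%:E)); rewrite geq_minr.
Qed.

(** * One constant for all comparisons *)

Let le_rhs (D D' : R) z (S : \bar R) : (D <= D')%R ->
  z <= D%:E * S `^ p^-1 -> z <= D'%:E * S `^ p^-1.
Proof.
by move=> DD' /le_trans; apply; rewrite lee_wpmul2r ?poweR_ge0// lee_fin.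
Qed.

Lemma ineq_monotone_upward : upward_closed (ineq_monotone p q a b u).
Proof. by move=> D D' DD' I x x0 xni; exact: le_rhs DD' (I x x0 xni). Qed.

Lemma ineq_sum_tail_upward : upward_closed (ineq_sum_tail p q a b u).
Proof. by move=> D D' DD' I y y0; exact: le_rhs DD' (I y y0). Qed.

Lemma ineq_weighted_sum_tail_upward : upward_closed (ineq_weighted_sum_tail p q a b u).
Proof. by move=> D D' DD' I y y0; exact: le_rhs DD' (I y y0). Qed.

Lemma ineq_sup_tail_upward : upward_closed (ineq_sup_tail p q a b u).
Proof. by move=> D D' DD' I y y0; exact: le_rhs DD' (I y y0). Qed.

Lemma ineq_sum_sup_upward : upward_closed (ineq_sum_sup p q a b u).
Proof. by move=> D D' DD' I y y0; exact: le_rhs DD' (I y y0). Qed.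

Lemma ineq_sup_sup_upward : upward_closed (ineq_sup_sup p q a b u).
Proof. by move=> D D' DD' I y y0; exact: le_rhs DD' (I y y0). Qed.

Let kappa : R := ((32 / p) `^ p^-1)%R.

(** Allows the implications that keep the constant to be stated with [kappa] as well. *)
Lemma kappa_ge1 : (1 <= kappa)%R.
Proof.
suff : (1 `^ p^-1 <= kappa)%R by rewrite powR1.
rewrite ge0_ler_powR ?nnegrE ?divr_ge0//.
by rewrite ler_pdivlMr// mul1r (le_trans p_le1)// ler1n.
Qed.

(** Only (vi) => (iii) changes the constant, and every route used between (i) and another inequality
    takes it at most once, so a single factor [kappa] is enough. *)
Lemma ineq_monotone_comparable :
  [/\ comparable kappa (ineq_monotone p q a b u) (ineq_sum_tail p q a b u),
      comparable kappa (ineq_monotone p q a b u) (ineq_weighted_sum_tail p q a b u),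
      comparable kappa (ineq_monotone p q a b u) (ineq_sup_tail p q a b u),
      comparable kappa (ineq_monotone p q a b u) (ineq_sum_sup p q a b u) &
      comparable kappa (ineq_monotone p q a b u) (ineq_sup_sup p q a b u)].
Proof.
have k1 := kappa_ge1; have k0 : (0 < kappa)%R by exact: lt_le_trans k1.
have same I J : upward_closed J -> (forall D, (0 < D)%R -> I D -> J D) ->
    transfers kappa I J.
  move=> upJ IJ; apply: (transfers_weaken (k := 1%R)) => // D D0 /(IJ D D0).
  by rewrite mul1r.
have vi_iii D (D0 : (0 < D)%R) := sup_sup_to_weighted_sum_tail D0.
have iii_ii D (D0 : (0 < D)%R) := weighted_sum_tail_to_sum_tail D0.
have ii_i D (D0 : (0 < D)%R) := sum_tail_to_monotone D0.
have i_ii D (D0 : (0 < D)%R) := monotone_to_sum_tail D0.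
have vi_i : transfers kappa (ineq_sup_sup p q a b u) (ineq_monotone p q a b u).
  move=> D D0 /(vi_iii D D0); have kD0 : (0 < kappa * D)%R by rewrite mulr_gt0.
  by move=> /(iii_ii _ kD0) /(ii_i _ kD0).
split.
- split; first exact: ineq_sum_tail_upward.
  + by apply: same i_ii; exact: ineq_sum_tail_upward.
  + by apply: same ii_i; exact: ineq_monotone_upward.
- split; first exact: ineq_weighted_sum_tail_upward.
  + move=> D D0 /(i_ii D D0) /sum_tail_to_sup_tail /sup_tail_to_sup_sup.
    exact: vi_iii.
  + apply: same; first exact: ineq_monotone_upward.
    by move=> D D0 /(iii_ii D D0); exact: ii_i.
- split; first exact: ineq_sup_tail_upward.
  + apply: same; first exact: ineq_sup_tail_upward.
    by move=> D D0 /(i_ii D D0) /sum_tail_to_sup_tail.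
  + by move=> D D0 /sup_tail_to_sup_sup; exact: vi_i.
- split; first exact: ineq_sum_sup_upward.
  + apply: same; first exact: ineq_sum_sup_upward.
    by move=> D D0 /(i_ii D D0) /sum_tail_to_sum_sup.
  + by move=> D D0 /sum_sup_to_sup_sup; exact: vi_i.
- split; first exact: ineq_sup_sup_upward.
  + apply: same; first exact: ineq_sup_sup_upward.
    by move=> D D0 /(i_ii D D0) /sum_tail_to_sup_tail /sup_tail_to_sup_sup.
  + exact: vi_i.
Qed.
End equivalences.

Theorem theorem3p2 (R : realType) (p q : R)
    (hq : 0 < q) (hp0 : 0 < p) (hp1 : p <= 1) :
  (forall a b u : nat -> R,
     nonneg_seq1 a -> nonneg_seq1 b -> nonneg_seq1 u -> 0 < b 1%N ->
     [<-> holds_with_finite_constant (ineq_monotone p q a b u);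
          holds_with_finite_constant (ineq_sum_tail p q a b u);
          holds_with_finite_constant (ineq_weighted_sum_tail p q a b u);
          holds_with_finite_constant (ineq_sup_tail p q a b u);
          holds_with_finite_constant (ineq_sum_sup p q a b u);
          holds_with_finite_constant (ineq_sup_sup p q a b u)])
  /\
  exists c : R, 0 < c /\
    forall a b u : nat -> R,
      nonneg_seq1 a -> nonneg_seq1 b -> nonneg_seq1 u -> 0 < b 1%N ->
      let C := best_constant (ineq_monotone p q a b u) in
      [/\ equiv_up_to c C (best_constant (ineq_sum_tail p q a b u)),
          equiv_up_to c C (best_constant (ineq_weighted_sum_tail p q a b u)),
          equiv_up_to c C (best_constant (ineq_sup_tail p q a b u)),
          equiv_up_to c C (best_constant (ineq_sum_sup p q a b u))
        & equiv_up_to c C (best_constant (ineq_sup_sup p q a b u))].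
Proof.
have k0 : 0 < (32 / p) `^ p^-1 by rewrite powR_gt0// divr_gt0.
split=> [a b u a0 b0 u0 b1|].
  have up := @ineq_monotone_upward R p q a b u.
  have [ii iii iv v vi] := ineq_monotone_comparable hq hp0 hp1 a0 b0 u0 b1.
  (* Neighbours in the cycle are linked through (i); the factor lost twice does not affect
     finiteness. *)
  have cI J J' : comparable ((32 / p) `^ p^-1) (ineq_monotone p q a b u) J ->
      comparable ((32 / p) `^ p^-1) (ineq_monotone p q a b u) J' ->
      holds_with_finite_constant J -> holds_with_finite_constant J'.
    move=> [upJ _ JI] [_ IJ' _] /(transfers_holds (ltW k0) upJ JI).
    exact: transfers_holds (ltW k0) up IJ'.
  tfae.
  - by case: ii => _ IJ _; exact: transfers_holds (ltW k0) up IJ.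
  - exact: cI ii iii.
  - exact: cI iii iv.
  - exact: cI iv v.
  - exact: cI v vi.
  - by case: vi => upJ _ JI; exact: transfers_holds (ltW k0) upJ JI.
exists ((32 / p) `^ p^-1); split=> // a b u a0 b0 u0 b1 /=.
have up := @ineq_monotone_upward R p q a b u.
have [[? ? ?] [? ? ?] [? ? ?] [? ? ?] [? ? ?]] :=
  ineq_monotone_comparable hq hp0 hp1 a0 b0 u0 b1.
by split; apply: transfers_equiv_up_to.
Qed.
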